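(* Let $$\mathcal{D} = \sum_{i=1}^\infty x_{i+1} \frac{\partial}{\partial x_i} + \sum_{i,j \geq 1} x_1 x_i x_j \frac{\partial}{\partial x_{i+j}},$$ and put $A_1 = x_1$ and $C_2 = x_1^2$. Define formal power series in $\lambda$ with coefficients in $\mathbb{Z}[x_1, x_2, \dotsc] \otimes \mathbb{Q}$ by $$\mathcal{A}(\lambda) = \exp(\lambda \mathcal{D}) A_1 = \sum_{n=0}^\infty \mathcal{D}^n A_1 \frac{\lambda^n}{n!}, \qquad \mathcal{C}(\lambda) = \exp(\lambda \mathcal{D}) C_2 = \sum_{n=0}^\infty \mathcal{D}^n C_2 \frac{\lambda^n}{n!} .$$ Then $$\mathcal{C}(\lambda) = \mathcal{A}(\lambda)^2 = \big( \exp(\lambda \mathcal{D}) A_1 \big)^2 .$$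
   Context: The operator $\mathcal{D}$ is a formal infinite sum acting on polynomials in the infinitely many variables $x_1, x_2, \dotsc$; on each polynomial only finitely many terms are nonzero. *)

(* Defs.v *)
From HB Require Import structures.
From mathcomp Require Import all_boot all_order all_algebra finmap.
From mathcomp Require Import monalg.
From mathcomp Require Import boolp classical_sets fsbigop.
Set Implicit Arguments.
Unset Strict Implicit.
Unset Printing Implicit Defensive.
Import GRing.Theory.
Local Open Scope ring_scope.

(* The indeterminates x_1, x_2, ... are indexed from 0 by nat:
   [X i] is x_(i+1) and [pderiv i] is the derivative in x_(i+1). *)
Definition pol := {malg rat[cmonom nat]}.

Definition X (i : nat) : pol := << ucm i >>.

Definition pderiv (i : nat) (p : pol) : pol :=
  \sum_(m <- msupp p) << p@_m *+ m i *g divcm m (ucm i) >>.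

(* For each p only finitely many summands are nonzero, so both sums over an
   infinite set are genuine finitely supported sums.  In the second one,
   u = (i, j) stands for the pair of subscripts (i+1, j+1), whence the
   derivative in x_(i+j+2). *)
Definition opD (p : pol) : pol :=
  \sum_(i \in [set: nat]) X i.+1 * pderiv i p
  + \sum_(u \in [set: nat * nat]) X 0 * X u.1 * X u.2 * pderiv (u.1 + u.2).+1 p.

(* A formal power series in lambda is its sequence of coefficients. *)
Definition fps := nat -> pol.

Definition fps_mul (f g : fps) : fps :=
  fun n => \sum_(i < n.+1) f i * g (n - i)%N.

Definition exp_lambda (F : pol -> pol) (p : pol) : fps :=
  fun n => (n`!%:R : rat)^-1 *: iter n F p.

Definition A1 : pol := X 0.

Definition C2 : pol := X 0 ^+ 2.

Definition calA : fps := exp_lambda opD A1.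

Definition calC : fps := exp_lambda opD C2.

(* Main.v *)
From HB Require Import structures.
From mathcomp Require Import all_boot all_order all_algebra finmap.
From mathcomp Require Import monalg.
From mathcomp Require Import boolp classical_sets fsbigop.
Require Import Defs.
Set Implicit Arguments.
Unset Strict Implicit.
Unset Printing Implicit Defensive.
Import GRing.Theory Num.Theory.
Local Open Scope ring_scope.

(* On any two given polynomials, their sum and their product, [opD] agrees with
   a finite combination of partial derivatives, so it is a derivation. By
   Leibniz' formula for the iterates of a derivation, its exponential is
   multiplicative, and C_2 = A_1 ^ 2. *)

Definition derivation (R : pzRingType) (D : R -> R) : Prop :=
  {morph D : p q / p + q} /\ forall p q, D (p * q) = D p * q + p * D q.

Lemma derivation_zmod_morphism (R : pzRingType) (D : R -> R) :
  derivation D -> zmod_morphism D.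
Proof. by move=> [DD _] p q; apply: (addIr (D q)); rewrite -DD !subrK. Qed.

Lemma derivation_add (R : pzRingType) (D E : R -> R) :
  derivation D -> derivation E -> derivation (fun p => D p + E p).
Proof.
move=> [DD DM] [ED EM]; split=> p q; first by rewrite DD ED addrACA.
by rewrite DM EM mulrDl mulrDr addrACA.
Qed.

(** Commutativity lets the coefficient [c i] move past [p] in the second Leibniz term. *)
Lemma derivation_sum (R : comPzRingType) (I : Type) (r : seq I)
    (c : I -> R) (D : I -> R -> R) :
  (forall i, derivation (D i)) -> derivation (fun p => \sum_(i <- r) c i * D i p).
Proof.
move=> dD; split=> p q; rewrite ?mulr_suml ?mulr_sumr -big_split /=;
  apply: eq_bigr => i _; have [DD DM] := dD i; first by rewrite DD mulrDr.
by rewrite DM mulrDr mulrA [p * (_ * _)]mulrCA.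
Qed.

Lemma iter_derivationM (R : pzRingType) (D : R -> R) n p q : derivation D ->
  iter n D (p * q)
    = \sum_(i < n.+1) (iter i D p * iter (n - i) D q) *+ 'C(n, i).
Proof.
move=> dD; have [_ DM] := dD.
(* [D] is repackaged as an additive map, so that [raddf_sum] and [raddfMn] apply to it. *)
pose addD := GRing.isZmodMorphism.Build R R D (derivation_zmod_morphism dD).
pose D' : {additive R -> R} := HB.pack D addD.
rewrite -[D]/(D' : R -> R) in DM *; move: D' DM => {dD addD} {}D DM.
elim: n => [|n IHn]; first by rewrite big_ord1.
rewrite iterS IHn raddf_sum /=.
under eq_bigr => i _ do
  rewrite raddfMn /= DM -!iterS -(subSn (ltn_ord i : i <= n)%N) mulrnDl.
rewrite big_split /= [RHS]big_ord_recl subn0 bin0.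
under [in RHS]eq_bigr => i _ do rewrite lift0 binS subSS mulrnDr.
(* Of the two halves given by Pascal's rule, the one with ['C(n, i)] collects the terms where [D]
   hits [p]; the other, together with the term split off at index 0, those where [D] hits [q]. *)
rewrite [in RHS]big_split /= [RHS]addrA [RHS]addrC; congr (_ + _).
rewrite big_ord_recl subn0 bin0; congr (_ + _).
rewrite [RHS]big_ord_recr /= (bin_small (ltnSn n)) mulr0n addr0.
by apply: eq_bigr => i _; rewrite /bump add1n subSS.
Qed.

(** Dividing Leibniz' formula by n! turns each binomial coefficient into 1 / (i! (n - i)!), which
    gives a Cauchy product. *)
Lemma exp_derivationM (F : numFieldType) (A : algType F) (D : A -> A) n p q :
    derivation D ->
  (n`!%:R : F)^-1 *: iter n D (p * q)
    = \sum_(i < n.+1) ((i`!%:R : F)^-1 *: iter i D p)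
                       * (((n - i)`!%:R : F)^-1 *: iter (n - i) D q).
Proof.
move=> dD; rewrite iter_derivationM // scaler_sumr; apply: eq_bigr => i _.
have le_in : (i <= n)%N by rewrite -ltnS.
rewrite -scalerAl -scalerAr !scalerA -scaler_nat scalerA; congr (_ *: _).
rewrite -(bin_fact le_in) !natrM invfM mulrAC mulVf ?mul1r ?invfM //.
by rewrite pnatr_eq0 -lt0n bin_gt0.
Qed.

Lemma malg_ind (K : choiceType) (G : zmodType) (P : {malg G[K]} -> Prop) :
    (forall p q, P p -> P q -> P (p + q)) -> (forall c k, P << c *g k >>) ->
  P 0 -> forall p, P p.
Proof. by move=> PD PU P0 p; rewrite (monalgE p); apply: big_ind. Qed.

Lemma malgUM (K : monomType) (R : nzRingType) (c1 c2 : R) (k1 k2 : K) :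
  << c1 *g k1 >> * << c2 *g k2 >> = << c1 * c2 *g mmul k1 k2 >>.
Proof. by rewrite malgM_def fgmulUU. Qed.

(** As a [mmap], the derivative inherits additivity, and its value on a monomial can be read off. *)
Lemma pderivE i (p : pol) :
  pderiv i p = mmap (@malgC {cmonom nat} rat)
                 (fun m => << (m i)%:R *g divcm m (ucm i) >>) p.
Proof.
by rewrite mmapE; apply: eq_bigr => m _; rewrite malgUM mul1m mulr_natr.
Qed.

Lemma pderivD i : {morph pderiv i : p q / p + q}.
Proof. by move=> p q; rewrite !pderivE raddfD. Qed.

Lemma pderiv0 i : pderiv i 0 = 0.
Proof. by rewrite pderivE raddf0. Qed.

Lemma pderivU i (c : rat) m :
  pderiv i << c *g m >> = << c *+ m i *g divcm m (ucm i) >>.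
Proof. by rewrite pderivE mmapU malgUM mul1m mulr_natr. Qed.

(** Exponents are subtracted with truncation at 0; positivity of [m1 i] ensures that nothing is
    truncated. *)
Lemma divcm_mull (m1 m2 : {cmonom nat}) i : (0 < m1 i)%N ->
  divcm (mmul m1 m2) (ucm i) = mmul (divcm m1 (ucm i)) m2.
Proof.
move=> m1i; apply/eqP/cmP => j; rewrite cmM !divcmE cmM ucmE.
by case: eqVneq => [<-|_]; rewrite ?subn0 // addnBAC.
Qed.

Lemma divcm_mulr (m1 m2 : {cmonom nat}) i : (0 < m2 i)%N ->
  divcm (mmul m1 m2) (ucm i) = mmul m1 (divcm m2 (ucm i)).
Proof. by move=> m2i; rewrite (mulmC m1) divcm_mull // mulmC. Qed.

(** Both sides of the Leibniz rule are additive in [p] and in [q], so monomials suffice. *)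
Lemma malg_derivation (K : monomType) (R : nzRingType)
    (D : {malg R[K]} -> {malg R[K]}) :
    {morph D : p q / p + q} -> D 0 = 0 ->
    (forall c d k l, D (<< c *g k >> * << d *g l >>)
       = D << c *g k >> * << d *g l >> + << c *g k >> * D << d *g l >>) ->
  derivation D.
Proof.
move=> DD D0 DM; split=> // p q; elim/malg_ind: p => [p1 p2 IH1 IH2|c k|].
- by rewrite mulrDl !DD IH1 IH2 !mulrDl addrACA.
- elim/malg_ind: q => [q1 q2 IH1 IH2|d l|].
  + by rewrite mulrDr !DD IH1 IH2 !mulrDr addrACA.
  + exact: DM.
  + by rewrite D0 !mulr0 D0 addr0.
- by rewrite D0 !mul0r D0 addr0.
Qed.

Lemma pderiv_derivation i : derivation (pderiv i).
Proof.
apply: malg_derivation => [||c d k l]; [exact: pderivD|exact: pderiv0|].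
(* Without the patterns, unification unfolds the finitely supported maps and
   does not return. *)
rewrite malgUM [LHS]pderivU.
rewrite [X in _ = X * _ + _]pderivU [X in _ = _ + _ * X]pderivU.
rewrite [X in _ = X + _]malgUM [X in _ = _ + X]malgUM.
rewrite cmM mulrnDr [LHS]monalgUD [c *+ _ * _]mulrnAl [_ * (_ *+ _)]mulrnAr.
apply: f_equal2.
  (* When the exponent is 0, the truncated quotients may differ, but their coefficients vanish. *)
  by case: (posnP (k i)) => [->|/divcm_mull ->//]; rewrite !mulr0n !monalgU0.
by case: (posnP (l i)) => [->|/divcm_mulr ->//]; rewrite !mulr0n !monalgU0.
Qed.

Lemma pderiv_eventually0 p :
  exists N, forall i, (N <= i)%N -> pderiv i p = 0.
Proof.
elim/malg_ind: p => [p q [N pN] [M qM]|c m|].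
- exists (maxn N M) => i; rewrite geq_max => /andP[Ni Mi].
  by rewrite pderivD pN // qM // addr0.
(* The bound is one more than the largest index of a variable in [m], or 0 if [m] is trivial. *)
- exists (\max_(j <- finsupp m) j.+1)%N => i le_i.
  rewrite pderivU; case: (finsuppP m i) => [_|mi].
    by rewrite mulr0n monalgU0.
  by have := leq_trans (@leq_bigmax_seq _ _ xpredT succn i mi isT) le_i; rewrite ltnn.
- by exists 0%N => i _; rewrite pderiv0.
Qed.

Definition opD_upto N (p : pol) : pol :=
  \sum_(i <- iota 0 N) X i.+1 * pderiv i p
  + \sum_(u <- [seq (i, j) | i <- iota 0 N, j <- iota 0 N])
      X 0 * X u.1 * X u.2 * pderiv (u.1 + u.2).+1 p.

Lemma opDE N p : (forall i, (N <= i)%N -> pderiv i p = 0) ->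
  opD p = opD_upto N p.
Proof.
move=> pN; rewrite /opD /opD_upto.
rewrite (fsbigE (iota 0 N)) ?iota_uniq //; last first.
  by move=> i _; rewrite mem_iota /= -leqNgt => /pN ->; rewrite mulr0.
rewrite (fsbigE [seq (i, j) | i <- iota 0 N, j <- iota 0 N]) //; last first.
(* A pair outside the square has an entry at least [N], hence so is the index i + j + 1 of its
   derivative. *)
- move=> [i j] _ /= ijN; rewrite pN ?mulr0 // leqNgt.
  apply: contra ijN => ijN; apply/allpairsP; exists (i, j).
  by rewrite !mem_iota /=; split=> //; apply: leq_ltn_trans ijN;
    rewrite ltnW // ltnS ?leq_addr ?leq_addl.
- by apply: allpairs_uniq; rewrite ?iota_uniq // => -[? ?] [].
by congr (_ + _); apply: eq_bigl => u; rewrite in_setT.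
Qed.

(** A bound beyond which all derivatives of [p] and [q] vanish also serves for the sum, by
    additivity, and for the product, by the Leibniz rule for [pderiv]. *)
Lemma opD_upto_common p q :
  exists N, [/\ opD p = opD_upto N p, opD q = opD_upto N q,
    opD (p + q) = opD_upto N (p + q) & opD (p * q) = opD_upto N (p * q)].
Proof.
have [N pN] := pderiv_eventually0 p; have [M qM] := pderiv_eventually0 q.
have pqN i : (maxn N M <= i)%N -> pderiv i p = 0 /\ pderiv i q = 0.
  by rewrite geq_max => /andP[/pN -> /qM ->].
exists (maxn N M); split; apply: opDE => i /pqN[p0 q0].
- exact: p0.
- exact: q0.
- by rewrite pderivD p0 q0 addr0.
- by rewrite (pderiv_derivation i).2 p0 q0 mul0r mulr0 addr0.
Qed.

Lemma opD_upto_derivation N : derivation (opD_upto N).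
Proof.
by apply: derivation_add; apply: derivation_sum => u; exact: pderiv_derivation.
Qed.

Lemma opD_derivation : derivation opD.
Proof.
split=> p q; have [N [-> -> opDD opDM]] := opD_upto_common p q;
  have [DD DM] := opD_upto_derivation N.
  by rewrite opDD DD.
by rewrite opDM DM.
Qed.

Lemma exp_lambdaM p q :
  exp_lambda opD (p * q) = fps_mul (exp_lambda opD p) (exp_lambda opD q).
Proof. by apply/funext => n; exact: exp_derivationM opD_derivation. Qed.

Theorem proposition6 :
  calC = fps_mul calA calA /\
  fps_mul calA calA = fps_mul (exp_lambda opD A1) (exp_lambda opD A1).
Proof. by split; rewrite // /calC /C2 expr2 exp_lambdaM. Qed.
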